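(* For any integer $n\ge2$ and any real number $q>1$, $$\mathfrak F(n,q)=0\quad\Longleftrightarrow\quad n\text{ is a prime number}.$$
   Context: For $z\in\mathbb C$ and an integer $i\ge2$, $F(z,i)=i+2\sum_{k=1}^{i-1}(i-k)\cos(2\pi kz/i)$. For $q>1$, $$\mathfrak F(z,q)=(q-1)q\left(\sum_{i=2}^{\infty}\frac{F(z,i)}{i^2}\,q^{-i}-q^{-z}\right),$$ where $q^{-z}=e^{-z\log q}$ with the real logarithm. *)

(* Defs.v *)
From Stdlib Require Import Reals ZArith Znumtheory.
From Coquelicot Require Import Coquelicot.

Open Scope R_scope.

Definition Cexp (z : C) : C :=
  (RtoC (exp (Re z)) * (RtoC (cos (Im z)) + Ci * RtoC (sin (Im z))))%C.

Definition Ccos (z : C) : C :=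
  ((Cexp (Ci * z) + Cexp (- (Ci * z))) / RtoC 2)%C.

(* The limit of the partial sums in the normed space C; only meaningful when
   the series converges, in which case [is_series] has exactly one witness. *)
Definition CSeries (a : nat -> C) : C :=
  iota (T := C_CompleteNormedModule)
    (fun l : C => is_series (K := C_AbsRing) (V := C_NormedModule) a l).

(* Meant for 2 <= i. *)
Definition F (z : C) (i : nat) : C :=
  (RtoC (INR i) +
   RtoC 2 *
   sum_n_m (G := C_AbelianMonoid)
     (fun k : nat =>
        RtoC (INR i - INR k) *
        Ccos (RtoC (2 * PI * INR k) * z / RtoC (INR i)))
     1 (i - 1))%C.

(* Complex power q^w = e^(w log q) of a real base q > 0, with the real logarithm. *)
Definition Rcpow (q : R) (w : C) : C := Cexp (w * RtoC (ln q))%C.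

(* The summation index is shifted: the term of rank m is that of i = m + 2. *)
Definition frakF (z : C) (q : R) : C :=
  (RtoC ((q - 1) * q) *
   (CSeries (fun m : nat =>
       let i := (m + 2)%nat in
       F z i / RtoC (INR i ^ 2) * RtoC (/ q ^ i))
    - Rcpow q (- z)))%C.

(* Main.v *)
Require Import Defs.
From Stdlib Require Import Reals ZArith Znumtheory Lra Lia.
From Coquelicot Require Import Coquelicot.

(** Pairing the terms [k] and [-k] shows that [F(n,i)] is [i] times the Fejer
kernel of order [i] at the angle [t = 2 pi n / i].  That kernel satisfies
[F(n,i) (1 - cos t) = 1 - cos (i t)] ([fejer_kernel]), and here [i t = 2 pi n],
so the right-hand side is [0].  Hence [F(n,i) = 0] unless [cos t = 1], which
happens exactly when [i] divides [n]; in that case every cosine in the sum is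
[1] and [F(n,i) = i^2].  In short, [F(n,i) / i^2] is the indicator of [i | n]
([fejer_sum_divide]).

The series is therefore the finite sum of [q^(-i)] over the divisors [i >= 2]
of [n] ([frakF_sum]).  Its term [i = n] is cancelled by [q^(-n)], and what
remains is a sum of positive terms over the divisors [2 <= i < n]: it vanishes
exactly when there is no such divisor, that is, when [n] is prime. *)

(** * The Fejer kernel *)

Definition fejer_sum (t : R) (m : nat) : R :=
  INR m + 2 * sum_n_m (fun k => (INR m - INR k) * cos (INR k * t)) 1 (m - 1).

(** Raising the order adds one to each of the weights [m - k], so the increment
is a Dirichlet kernel. *)
Lemma fejer_sum_S (t : R) (m : nat) :
  fejer_sum t (S m) = fejer_sum t m + (1 + 2 * sum_n_m (fun k => cos (INR k * t)) 1 m).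
Proof.
  unfold fejer_sum; rewrite S_INR.
  replace (S m - 1)%nat with m by lia.
  destruct m as [|m].
  - rewrite !sum_n_m_zero by lia. simpl; unfold zero; simpl; lra.
  - replace (S m - 1)%nat with m by lia.
    rewrite !(sum_n_Sm _ 1 m) by lia.
    rewrite (sum_n_m_ext (fun k => (INR (S m) + 1 - INR k) * cos (INR k * t))
      (fun k => plus ((INR (S m) - INR k) * cos (INR k * t)) (cos (INR k * t))))
      by (intros k; unfold plus; simpl; ring).
    rewrite sum_n_m_plus. unfold plus; simpl; ring.
Qed.

(** The product-to-sum formula makes the left-hand side telescope: the factor
[1 - cos t] turns the sum into second differences of [cos (k t)]. *)
Lemma dirichlet_kernel (t : R) (m : nat) :
  (1 + 2 * sum_n_m (fun k => cos (INR k * t)) 1 m) * (1 - cos t)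
  = cos (INR m * t) - cos (INR (S m) * t).
Proof.
  induction m as [|m IH].
  - rewrite sum_n_m_zero by lia. simpl; unfold zero; simpl.
    rewrite Rmult_0_l, Rmult_1_l, cos_0; ring.
  - rewrite sum_n_Sm by lia. unfold plus; simpl.
    rewrite Rmult_plus_distr_l, <- Rplus_assoc, Rmult_plus_distr_r.
    change (match m with O => 1 | S _ => INR m + 1 end) with (INR (S m)).
    rewrite IH.
    (* The angles [m t] and [(m + 2) t] are symmetric about [(m + 1) t]. *)
    replace (INR (S m) + 1) with (INR m + 2) by (rewrite S_INR; ring).
    replace (INR m * t) with (INR (S m) * t - t) by (rewrite S_INR; ring).
    replace ((INR m + 2) * t) with (INR (S m) * t + t) by (rewrite S_INR; ring).
    rewrite cos_plus, cos_minus; ring.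
Qed.

(** This is the closed form [sin^2 (m t / 2) / sin^2 (t / 2)], cleared of its
denominator so that it also holds where [cos t = 1].  It follows by summing
[dirichlet_kernel] over the order. *)
Lemma fejer_kernel (t : R) (m : nat) :
  fejer_sum t m * (1 - cos t) = 1 - cos (INR m * t).
Proof.
  induction m as [|m IH].
  - unfold fejer_sum. rewrite sum_n_m_zero by lia. simpl; unfold zero; simpl.
    rewrite Rmult_0_l, cos_0; ring.
  - rewrite fejer_sum_S, Rmult_plus_distr_r, IH, dirichlet_kernel; ring.
Qed.

Lemma fejer_sum_full (t : R) (m : nat) :
  (forall k, cos (INR k * t) = 1) -> fejer_sum t m = INR m ^ 2.
Proof.
  intros Hcos; induction m as [|m IH].
  - unfold fejer_sum. rewrite sum_n_m_zero by lia. simpl; unfold zero; simpl; ring.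
  - rewrite fejer_sum_S, IH.
    rewrite (sum_n_m_ext _ (fun _ => 1)) by exact Hcos.
    rewrite sum_n_m_const, S_INR.
    replace (S m - 1)%nat with m by lia. ring.
Qed.

(** * Detecting divisors by cosines *)

Lemma cos_2PI_mult (k : Z) : cos (2 * PI * IZR k) = 1.
Proof.
  replace (2 * PI * IZR k) with (2 * (IZR k * PI)) by ring.
  rewrite cos_2a_sin, (sin_eq_0_1 (IZR k * PI)) by (exists k; reflexivity).
  ring.
Qed.

Lemma cos_eq_1_divide (n : Z) (i : nat) :
  (0 < i)%nat -> cos (2 * PI * IZR n / INR i) = 1 -> (Z.of_nat i | n)%Z.
Proof.
  intros Hi Hcos.
  assert (Hi0 : INR i <> 0) by (apply not_0_INR; lia).
  replace (2 * PI * IZR n / INR i) with (2 * (PI * IZR n / INR i)) in Hcos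
    by (field; exact Hi0).
  rewrite cos_2a_sin in Hcos.
  assert (Hsin : sin (PI * IZR n / INR i) = 0) by nra.
  destruct (sin_eq_0_0 _ Hsin) as [k Hk].
  exists k. apply eq_IZR. rewrite mult_IZR, <- INR_IZR_INZ.
  apply (Rmult_eq_reg_l PI); [|exact PI_neq0].
  replace (PI * IZR n) with (PI * IZR n / INR i * INR i) by (field; exact Hi0).
  rewrite Hk; ring.
Qed.

Definition divisor_weight (n : Z) (w : nat -> R) (i : nat) : R :=
  if Zdivide_dec (Z.of_nat i) n then w i else 0.

(** If [i] divides [n], the angle is a multiple of [2 pi] and all cosines are [1].
Otherwise [1 - cos t] is invertible, and [fejer_kernel] forces the sum to vanish
because [i t] is a multiple of [2 pi]. *)
Lemma fejer_sum_divide (n : Z) (i : nat) :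
  (0 < i)%nat ->
  fejer_sum (2 * PI * IZR n / INR i) i
  = divisor_weight n (fun i => INR i ^ 2) i.
Proof.
  intros Hi.
  assert (Hi0 : INR i <> 0) by (apply not_0_INR; lia).
  unfold divisor_weight; destruct (Zdivide_dec (Z.of_nat i) n) as [[d Hd]|Hn].
  - apply fejer_sum_full; intros k.
    rewrite Hd, mult_IZR, <- INR_IZR_INZ.
    replace (INR k * (2 * PI * (IZR d * INR i) / INR i))
      with (2 * PI * IZR (Z.of_nat k * d))
      by (rewrite mult_IZR, <- INR_IZR_INZ; field; exact Hi0).
    apply cos_2PI_mult.
  - assert (Hne : 1 - cos (2 * PI * IZR n / INR i) <> 0).
    { intros H; apply Hn, cos_eq_1_divide; [exact Hi | lra]. }
    apply (Rmult_eq_reg_r _ _ _) with (2 := Hne).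
    rewrite fejer_kernel.
    replace (INR i * (2 * PI * IZR n / INR i)) with (2 * PI * IZR n)
      by (field; exact Hi0).
    rewrite cos_2PI_mult; ring.
Qed.

(** * Complex functions at real arguments *)

Lemma Cexp_RtoC (x : R) : Cexp (RtoC x) = RtoC (exp x).
Proof.
  unfold Cexp; simpl. rewrite cos_0, sin_0.
  apply injective_projections; simpl; ring.
Qed.

Lemma Ccos_RtoC (x : R) : Ccos (RtoC x) = RtoC (cos x).
Proof.
  unfold Ccos, Cexp; simpl.
  replace (0 * x - 1 * 0) with 0 by ring.
  replace (0 * 0 + 1 * x) with x by ring.
  rewrite Ropp_0, exp_0, cos_neg, sin_neg.
  apply injective_projections; simpl; field.
Qed.

Lemma sum_n_m_RtoC (u : nat -> R) (a b : nat) :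
  sum_n_m (G := C_AbelianMonoid) (fun k => RtoC (u k)) a b
  = RtoC (sum_n_m u a b).
Proof.
  destruct (Nat.le_gt_cases a b) as [Hab|Hab].
  - induction Hab as [|b Hab IH].
    + rewrite !sum_n_n; reflexivity.
    + rewrite !sum_n_Sm by lia. rewrite IH.
      unfold plus at 2; simpl. rewrite RtoC_plus; reflexivity.
  - rewrite !sum_n_m_zero by lia; reflexivity.
Qed.

Lemma F_fejer_sum (x : R) (i : nat) :
  (0 < i)%nat -> F (RtoC x) i = RtoC (fejer_sum (2 * PI * x / INR i) i).
Proof.
  intros Hi.
  assert (Hi0 : INR i <> 0) by (apply not_0_INR; lia).
  unfold F, fejer_sum.
  rewrite RtoC_plus, RtoC_mult, <- sum_n_m_RtoC.
  do 2 f_equal. apply sum_n_m_ext; intros k.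
  rewrite <- RtoC_mult, <- RtoC_div, Ccos_RtoC, <- RtoC_mult by exact Hi0.
  do 3 f_equal. field; exact Hi0.
Qed.

(** * Series with finitely many terms *)

Lemma is_series_finite {K : AbsRing} {V : NormedModule K} (a : nat -> V) (N : nat) :
  (forall m, (N < m)%nat -> a m = zero) -> is_series a (sum_n a N).
Proof.
  intros Ha. unfold is_series.
  apply (filterlim_ext_loc (fun _ => sum_n a N)); [|apply filterlim_const].
  exists N; intros m Hm.
  induction Hm as [|m Hm IH]; [reflexivity|].
  rewrite sum_Sn, <- IH, Ha by lia. symmetry; apply plus_zero_r.
Qed.

Lemma CSeries_finite (a : nat -> C) (N : nat) :
  (forall m, (N < m)%nat -> a m = RtoC 0) ->
  CSeries a = sum_n (G := C_AbelianMonoid) a N.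
Proof.
  intros Ha. unfold CSeries.
  assert (Hs : is_series (K := C_AbsRing) (V := C_NormedModule) a
                 (sum_n (G := C_AbelianMonoid) a N))
    by (apply (is_series_finite (V := C_NormedModule)); exact Ha).
  apply (iota_unique (V := C_CompleteNormedModule)); [|exact Hs].
  intros y Hy.
  exact (filterlim_locally_unique (V := C_NormedModule) _ _ _ Hy Hs).
Qed.

(** * Divisors and primality *)

Lemma sum_n_nonneg_eq_last (a : nat -> R) (N : nat) :
  (forall m, 0 <= a m) ->
  (sum_n a N = a N <-> forall m, (m < N)%nat -> a m = 0).
Proof.
  intros Ha.
  assert (Hpos : forall M, 0 <= sum_n a M).
  { induction M as [|M IH]; [rewrite sum_O; apply Ha|].
    rewrite sum_Sn; unfold plus; simpl; specialize (Ha (S M)); lra. }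
  assert (Hzero : forall M, sum_n a M = 0 <-> forall m, (m <= M)%nat -> a m = 0).
  { induction M as [|M IH].
    - rewrite sum_O; split; [|intros H; apply H; lia].
      intros H m Hm; replace m with 0%nat by lia; exact H.
    - rewrite sum_Sn; unfold plus; simpl.
      specialize (Hpos M). pose proof (Ha (S M)) as HM. split.
      + intros H m Hm. destruct (Nat.eq_dec m (S M)) as [->|]; [lra|].
        apply IH; [lra|lia].
      + intros H. rewrite (proj2 IH), H by (lia || (intros; apply H; lia)). ring. }
  destruct N as [|N].
  - rewrite sum_O; split; [lia|reflexivity].
  - rewrite sum_Sn; unfold plus; simpl. split.
    + intros H m Hm; apply (proj1 (Hzero N)); [lra|lia].
    + intros H; rewrite (proj2 (Hzero N)) by (intros; apply H; lia). ring.
Qed.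

(** Candidate divisors are written [m + 2] so as to match the ranks of the
terms of the series; the rank of the divisor [n] itself is [n - 2]. *)
Lemma prime_iff_no_divisor (n : Z) :
  (2 <= n)%Z ->
  (prime n <-> forall m, (m < Z.to_nat n - 2)%nat -> ~ (Z.of_nat (m + 2) | n)%Z).
Proof.
  intros Hn; split.
  - intros Hp m Hm Hd.
    destruct (prime_divisors n Hp _ Hd) as [|[|[|]]]; lia.
  - intros H. destruct (prime_dec n) as [|Hnp]; [assumption|exfalso].
    destruct (not_prime_divide n) as [d [Hd Hdn]]; [lia|exact Hnp|].
    apply (H (Z.to_nat d - 2)%nat); [lia|].
    replace (Z.of_nat (Z.to_nat d - 2 + 2)) with d by lia. exact Hdn.
Qed.

(** A positive [n] has no divisor above [n], so the series stops at rank
[n - 2]. *)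
Lemma frakF_sum (n : Z) (q : R) :
  (2 <= n)%Z -> (1 < q)%R ->
  frakF (RtoC (IZR n)) q =
  RtoC ((q - 1) * q *
    (sum_n (fun m => divisor_weight n (fun i => / q ^ i) (m + 2)) (Z.to_nat n - 2)
     - / q ^ Z.to_nat n)).
Proof.
  intros Hn Hq. unfold frakF.
  assert (Hterm : forall m : nat,
    (F (IZR n) (m + 2) / RtoC (INR (m + 2) ^ 2) * RtoC (/ q ^ (m + 2)))%C
    = RtoC (divisor_weight n (fun i => / q ^ i) (m + 2))).
  { intros m.
    assert (Hi0 : INR (m + 2) <> 0) by (apply not_0_INR; lia).
    rewrite F_fejer_sum, fejer_sum_divide by lia.
    rewrite <- RtoC_div, <- RtoC_mult by (apply pow_nonzero; exact Hi0).
    f_equal. unfold divisor_weight; destruct Zdivide_dec; field;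
      (split; [apply pow_nonzero; lra | exact Hi0]). }
  rewrite (CSeries_finite _ (Z.to_nat n - 2)).
  - unfold sum_n; rewrite (sum_n_m_ext (G := C_AbelianMonoid) _ _ _ _ Hterm).
    rewrite sum_n_m_RtoC.
    unfold Rcpow. rewrite <- RtoC_opp, <- RtoC_mult, Cexp_RtoC.
    replace (exp (- IZR n * ln q)) with (/ q ^ Z.to_nat n).
    + rewrite <- RtoC_minus, <- RtoC_mult; reflexivity.
    + rewrite Ropp_mult_distr_l_reverse, exp_Ropp. f_equal.
      rewrite <- Rpower_pow by lra. unfold Rpower.
      rewrite INR_IZR_INZ, Z2Nat.id by lia. reflexivity.
  - intros m Hm. cbv zeta. rewrite Hterm. f_equal.
    unfold divisor_weight; destruct Zdivide_dec as [Hd|]; [|reflexivity].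
    apply Z.divide_pos_le in Hd; lia.
Qed.

Theorem theorem4p3 :
  forall (n : Z) (q : R),
    (2 <= n)%Z -> (1 < q)%R ->
    (frakF (RtoC (IZR n)) q = RtoC 0 <-> prime n).
Proof.
  intros n q Hn Hq.
  rewrite frakF_sum, prime_iff_no_divisor by assumption.
  set (a := fun m => divisor_weight n (fun i => / q ^ i) (m + 2)).
  assert (Hw : forall i, 0 < / q ^ i)
    by (intros i; apply Rinv_0_lt_compat, pow_lt; lra).
  assert (Hlast : / q ^ Z.to_nat n = a (Z.to_nat n - 2)%nat).
  { unfold a, divisor_weight.
    replace (Z.to_nat n - 2 + 2)%nat with (Z.to_nat n) by lia.
    destruct Zdivide_dec as [|Hd]; [reflexivity|].
    exfalso; apply Hd; rewrite Z2Nat.id by lia; apply Z.divide_refl. }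
  assert (Hnonneg : forall m, 0 <= a m).
  { intros m; unfold a, divisor_weight; specialize (Hw (m + 2)%nat).
    destruct Zdivide_dec; lra. }
  assert (Hzero : forall m, a m = 0 <-> ~ (Z.of_nat (m + 2) | n)%Z).
  { intros m; unfold a, divisor_weight; specialize (Hw (m + 2)%nat).
    destruct Zdivide_dec; split; intros; try tauto; lra. }
  rewrite Hlast.
  transitivity (sum_n a (Z.to_nat n - 2) = a (Z.to_nat n - 2)%nat).
  - assert (Hc : 0 < (q - 1) * q) by nra.
    split; intros H.
    + apply RtoC_inj in H. nra.
    + f_equal. rewrite H; ring.
  - rewrite sum_n_nonneg_eq_last by exact Hnonneg.
    split; intros H m Hm; apply Hzero, H, Hm.
Qed.
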